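(* Let $g:[0,\infty)\to\mathbb{R}$ be a convex differentiable function such that $g(0)>0$ and $\lim_{x\to\infty}g(x)=0$, and define $f:[0,\infty)\to\mathbb{R}$ by \[ f(x)=g\left(\frac{x}{2\sqrt{g(0)}}\right). \] Then for any $\alpha>0$, every solution $x:[0,\infty)\to[0,\infty)$ to the Nesterov ODE \[ \ddot x=-\frac{\alpha}{t}\,\dot x-f'(x),\qquad x(0)=0,\qquad \dot x(0)=0, \] satisfies $f(x(t))\ge g(t)$ for all $t\ge 0$.
   Context: A solution is a function which is $C^1$ on $[0,\infty)$, $C^2$ on $(0,\infty)$, satisfies the equation for all $t>0$ and the initial conditions at $t=0$. Derivatives of $g$ and $f$ at $0$ are one-sided. *)

(* Defs.v *)
From Stdlib Require Export Reals.
From Coquelicot Require Export Coquelicot.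
Open Scope R_scope.

(* Functions on [0, +oo) are represented by total functions R -> R; every
   notion below is relative to the domain, so that the values at negative
   arguments are irrelevant. *)
Definition nonneg_half_line (x : R) : Prop := 0 <= x.
Definition pos_half_line (x : R) : Prop := 0 < x.

Definition convex_on (D : R -> Prop) (g : R -> R) : Prop :=
  forall x y s : R, D x -> D y -> 0 <= s <= 1 ->
    g (s * x + (1 - s) * y) <= s * g x + (1 - s) * g y.

(* [D_in f d D x] says that (f y - f x) / (y - x) tends to [d x] as y tends
   to x within D, y <> x.  On [0, +oo) this is the ordinary derivative for
   x > 0 and the right derivative for x = 0. *)
Definition derivative_at_on (D : R -> Prop) (f : R -> R) (x l : R) : Prop :=
  D_in f (fun _ => l) D x.

Definition differentiable_on (D : R -> Prop) (f : R -> R) : Prop :=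
  forall x : R, D x -> exists l : R, derivative_at_on D f x l.

Definition derivative_on (D : R -> Prop) (f df : R -> R) : Prop :=
  forall x : R, D x -> derivative_at_on D f x (df x).

Definition rescale (g : R -> R) (x : R) : R := g (x / (2 * sqrt (g 0))).

(* [v] and [a] are the first and second derivatives of [x], and [l] is
   f'(x(t)). *)
Definition nesterov_solution (alpha : R) (f x : R -> R) : Prop :=
  (forall t : R, 0 <= t -> 0 <= x t) /\
  exists v a : R -> R,
    derivative_on nonneg_half_line x v /\
    continuous_on nonneg_half_line v /\
    derivative_on pos_half_line v a /\
    continuous_on pos_half_line a /\
    (forall t : R, 0 < t ->
       exists l : R, derivative_at_on nonneg_half_line f (x t) l /\
                     a t = - (alpha / t) * v t - l) /\
    x 0 = 0 /\ v 0 = 0.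

(* Main.v *)
(** Along a solution the energy [x'^2 / 2 + f (x)] has derivative
    [- (alpha / t) x'^2 <= 0], so it never exceeds its initial value [g 0].
    Since [f >= 0], this bounds the speed by [sqrt (2 * g 0)], hence
    [x t <= 2 * sqrt (g 0) * t]; as [g] is nonincreasing (it is convex with a
    finite limit), [f (x t) = g (x t / (2 * sqrt (g 0))) >= g t]. *)

Require Import Defs.
From Stdlib Require Import Reals Lra.
From Coquelicot Require Import Coquelicot.
Open Scope R_scope.

(** Bridges the epsilon-delta limits behind [D_in] and the filters behind [continuous_on]. *)
Lemma limit1_in_filterlim (f : R -> R) (D : R -> Prop) (l a : R) :
  limit1_in f D l a <-> filterlim f (within D (locally a)) (locally l).
Proof.
split.
- intros H.
  apply filterlim_locally; intros eps.
  destruct (H eps (cond_pos eps)) as [d [dpos Hd]].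
  exists (mkposreal d dpos); intros y Hy Dy.
  now apply Hd.
- intros H eps Heps.
  destruct (proj1 (filterlim_locally f l) H (mkposreal eps Heps)) as [d Hd].
  exists d; split; [apply cond_pos | intros y [Dy Hy]].
  now apply Hd.
Qed.

Lemma limit1_in_subset (f : R -> R) (D D' : R -> Prop) (l a : R) :
  (forall y, D' y -> D y) -> limit1_in f D l a -> limit1_in f D' l a.
Proof.
intros HD H eps Heps.
destruct (H eps Heps) as [d [dpos Hd]].
exists d; split; [exact dpos | intros y [Dy Hy]].
apply Hd; split; [apply HD, Dy | exact Hy].
Qed.

Lemma derivative_at_on_subset (D D' : R -> Prop) (f : R -> R) (t l : R) :
  (forall y, D' y -> D y) ->
  derivative_at_on D f t l -> derivative_at_on D' f t l.
Proof.
intros HD; apply limit1_in_subset.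
intros y [Dy Hy]; split; [apply HD, Dy | exact Hy].
Qed.

Lemma derivative_at_on_continue_in (D : R -> Prop) (f : R -> R) (t l : R) :
  derivative_at_on D f t l -> limit1_in f (D_x D t) (f t) t.
Proof. exact (cont_deriv f (fun _ => l) D t). Qed.

Lemma derivative_at_on_is_derive (f : R -> R) (t l : R) :
  0 < t -> derivative_at_on pos_half_line f t l -> is_derive f t l.
Proof.
intros Ht H; apply is_derive_Reals; intros eps Heps.
destruct (H eps Heps) as [d [dpos Hd]].
(* Radius at most [t] keeps [t + h] positive, so the restriction to the domain disappears and the
   derivative is two-sided. *)
assert (mpos : 0 < Rmin d t) by now apply Rmin_glb_lt.
exists (mkposreal _ mpos); intros h hne hlt; simpl in hlt.
assert (hd : Rabs h < d) by (apply Rlt_le_trans with (1 := hlt), Rmin_l).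
assert (ht : Rabs h < t) by (apply Rlt_le_trans with (1 := hlt), Rmin_r).
apply Rabs_def2 in ht.
specialize (Hd (t + h)); simpl in Hd; unfold Rdist in Hd.
replace (t + h - t) with h in Hd by ring.
apply Hd; split; [split; [unfold pos_half_line; lra | lra] | exact hd].
Qed.

Lemma derivative_at_on_comp (D E : R -> Prop) (f h : R -> R) (t l m : R) :
  (forall y, D y -> E (h y)) ->
  derivative_at_on D h t l -> derivative_at_on E f (h t) m ->
  derivative_at_on D (fun y => f (h y)) t (l * m).
Proof.
intros HDE Hh Hf.
(* [Dcomp] differentiates along [Dgf D E h], the points of [D] that [h] sends into [E]; by [HDE]
   these are all of [D]. *)
apply (derivative_at_on_subset (Dgf D E h)).
- intros y Dy; split; [exact Dy | apply HDE, Dy].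
- exact (Dcomp D E (fun _ => l) (fun _ => m) h f t Hh Hf).
Qed.

(** The mean value theorem on [[s, t]] with [0 < s] gives [h t <= h s]; then [s] tends to 0. Only a
    limit is asked for at 0, because the energy is differentiated only at positive times. *)
Lemma nonpos_derivative_le_start (h dh : R -> R) :
  limit1_in h pos_half_line (h 0) 0 ->
  (forall t, 0 < t -> is_derive h t (dh t)) ->
  (forall t, 0 < t -> dh t <= 0) ->
  forall t, 0 <= t -> h t <= h 0.
Proof.
intros Hlim Hder Hneg t [Ht | <-]; [|lra].
apply limit1_in_filterlim in Hlim.
apply (filterlim_le (F := at_right 0) (fun _ => h t) h (h t) (h 0)).
- exists (mkposreal t Ht); intros s Hs spos.
  apply Rabs_def2 in Hs; unfold minus, plus, opp in Hs; simpl in Hs.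
  destruct (MVT_gen h s t dh) as [c [Hc Heq]];
    rewrite ?Rmin_left, ?Rmax_right in * by lra.
  + intros y Hy; apply Hder; lra.
  + intros y Hy; apply continuity_pt_filterlim.
    apply (ex_derive_continuous h y); exists (dh y); apply Hder; lra.
  + assert (dh c <= 0) by (apply Hneg; lra); nra.
- apply filterlim_const.
- exact Hlim.
Qed.

Lemma convex_lim_nonincreasing (g : R -> R) (l : R) :
  convex_on nonneg_half_line g -> is_lim g p_infty l ->
  forall x y, 0 <= x -> x <= y -> g y <= g x.
Proof.
intros Hc Hl x y Hx [Hxy | <-]; [|lra].
apply Rnot_lt_le; intros Hlt.
apply is_lim_spec in Hl.
destruct (Hl (mkposreal 1 Rlt_0_1)) as [M HM]; simpl in HM.
(* By convexity an increase from [x] to [y] forces linear growth beyond [y], so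
   at [z] the value of [g] would exceed [l + 1]. *)
set (K := Rabs (l + 1 - g x) / (g y - g x)).
assert (HK : 0 <= K).
{ apply Rdiv_le_0_compat; [apply Rabs_pos | lra]. }
(* Past [M], [g] stays below [l + 1]. At least [K + 1] steps of length [y - x] from [x], convexity
   lifts [g] by at least [(K + 1) * (g y - g x)], more than [l + 1 - g x]. *)
set (z := Rmax (M + 1) (x + (K + 1) * (y - x))).
assert (HzM : M + 1 <= z) by apply Rmax_l.
assert (Hzx : x + (K + 1) * (y - x) <= z) by apply Rmax_r.
assert (Hz : z - x >= y - x) by nra.
assert (Hgz : g z < l + 1).
{ assert (H : M < z) by lra.
  specialize (HM z H); apply Rabs_def2 in HM; lra. }
(* The weight for which [y = s * x + (1 - s) * z]. *)
set (s := (z - y) / (z - x)).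
assert (Hs1 : (1 - s) * (z - x) = y - x) by (unfold s; field; lra).
assert (Hs : 0 <= s <= 1).
{ split; [apply Rdiv_le_0_compat; lra | nra]. }
assert (Hcv : g (s * x + (1 - s) * z) <= s * g x + (1 - s) * g z).
{ apply Hc; unfold nonneg_half_line; lra. }
replace (s * x + (1 - s) * z) with y in Hcv by lra.
assert (HKe : K * (g y - g x) = Rabs (l + 1 - g x)) by (unfold K; field; lra).
assert (Hab := Rle_abs (l + 1 - g x)).
assert (H1 : (1 - s) * (K + 1) <= 1).
{ apply Rmult_le_reg_r with (y - x); [lra |].
  rewrite <- Hs1 at 2; nra. }
assert (H2 : g y - g x <= (1 - s) * (K * (g y - g x))).
{ apply Rle_trans with (1 := (ltac:(lra) : g y - g x <= (1 - s) * (g z - g x))).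
  apply Rmult_le_compat_l; lra. }
assert (H3 : (1 - s) * (K + 1) * (g y - g x) <= 1 * (g y - g x)).
{ apply Rmult_le_compat_r; lra. }
(* Together [H2] and [H3] force [(1 - s) * (g y - g x) <= 0], although both factors are positive. *)
assert (0 < 1 - s) by nra.
nra.
Qed.

Lemma nonincreasing_ge_lim (g : R -> R) (l : R) :
  (forall x y, 0 <= x -> x <= y -> g y <= g x) -> is_lim g p_infty l ->
  forall x, 0 <= x -> l <= g x.
Proof.
intros Hm Hl x Hx.
apply (is_lim_le_loc g (fun _ => g x) p_infty l (g x)).
- exists x; intros y Hy; apply Hm; lra.
- exact Hl.
- apply is_lim_const.
Qed.

Lemma rescale_0 (g : R -> R) : rescale g 0 = g 0.
Proof. unfold rescale, Rdiv; now rewrite Rmult_0_l. Qed.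

Lemma rescale_differentiable (g : R -> R) :
  0 < g 0 -> differentiable_on nonneg_half_line g ->
  differentiable_on nonneg_half_line (rescale g).
Proof.
intros g0_pos g_diff y Hy.
assert (cpos : 0 < / (2 * sqrt (g 0))).
{ apply Rinv_0_lt_compat; assert (H := sqrt_lt_R0 _ g0_pos); lra. }
assert (Hpos : forall z, nonneg_half_line z ->
                 nonneg_half_line (z / (2 * sqrt (g 0)))).
{ unfold nonneg_half_line; intros z Hz; unfold Rdiv; nra. }
destruct (g_diff _ (Hpos y Hy)) as [l Hl].
eexists.
apply (derivative_at_on_comp nonneg_half_line nonneg_half_line g
         (fun z => z / (2 * sqrt (g 0))) y (/ (2 * sqrt (g 0))) l Hpos);
  [| exact Hl].
(* The difference quotient of a linear map is constant, so any radius works. *)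
intros eps Heps; exists 1; split; [lra | intros z [[_ Hzy] _]].
simpl; unfold Rdist.
replace (_ - _) with 0; [rewrite Rabs_R0; exact Heps |].
assert (0 < sqrt (g 0)) by now apply sqrt_lt_R0.
field; lra.
Qed.

Lemma nesterov_energy_bound (f x v a : R -> R) (alpha : R) :
  0 < alpha -> differentiable_on nonneg_half_line f ->
  (forall t, 0 <= t -> 0 <= x t) ->
  derivative_on nonneg_half_line x v ->
  continuous_on nonneg_half_line v ->
  derivative_on pos_half_line v a ->
  (forall t, 0 < t -> exists l,
     derivative_at_on nonneg_half_line f (x t) l /\
     a t = - (alpha / t) * v t - l) ->
  forall t, 0 <= t ->
    v t * v t / 2 + f (x t) <= v 0 * v 0 / 2 + f (x 0).
Proof.
intros alpha_pos f_diff x_pos Hx Hvc Hv Hode.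
assert (sub : forall y, pos_half_line y -> nonneg_half_line y).
{ unfold pos_half_line, nonneg_half_line; intros; lra. }
apply (nonpos_derivative_le_start (fun t => v t * v t / 2 + f (x t))
         (fun t => - (alpha / t) * (v t * v t))).
- apply limit_plus.
  + assert (Hv0 : limit1_in v pos_half_line (v 0) 0).
    { apply (limit1_in_subset v nonneg_half_line); [exact sub |].
      apply limit1_in_filterlim, Hvc; unfold nonneg_half_line; lra. }
    apply limit_mul; [now apply limit_mul |].
    intros eps Heps; exists 1; split; [lra | intros y _].
    simpl; unfold Rdist; rewrite Rminus_diag, Rabs_R0; exact Heps.
  (* Right-continuity of [f (x t)] at 0 follows from its one-sided differentiability there, by the
     chain rule. *)
  + destruct (f_diff (x 0)) as [l Hl]; [apply x_pos; lra |].
    apply (limit1_in_subset _ (D_x nonneg_half_line 0)).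
    * unfold D_x, pos_half_line, nonneg_half_line; intros; lra.
    * apply (derivative_at_on_continue_in _ (fun t => f (x t)) 0 (v 0 * l)).
      apply (derivative_at_on_comp _ nonneg_half_line); [exact x_pos | | exact Hl].
      apply Hx; unfold nonneg_half_line; lra.
- intros t Ht.
  (* The chain rule for [f (x t)] uses the same [l] as the equation, so the two terms [v t * l]
     cancel and only friction remains. *)
  destruct (Hode t Ht) as [l [Hl Ha]].
  assert (Hfx : is_derive (fun t => f (x t)) t (v t * l)).
  { apply derivative_at_on_is_derive; [exact Ht |].
    apply (derivative_at_on_comp _ nonneg_half_line).
    - intros y Hy; apply x_pos, sub, Hy.
    - apply (derivative_at_on_subset nonneg_half_line); [exact sub |].
      apply Hx, sub, Ht.
    - exact Hl. }
  assert (Hvd : is_derive v t (a t)).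
  { apply derivative_at_on_is_derive; [exact Ht | apply Hv, Ht]. }
  (* Keeps the composite opaque: otherwise [auto_derive] would ask for a two-sided derivative of [f]
     at [x t], which may fail when [x t = 0]. *)
  set (fx := fun t => f (x t)) in *.
  change (is_derive (fun t => v t * v t / 2 + fx t) t
            (- (alpha / t) * (v t * v t))).
  auto_derive.
  + repeat split; eexists; eassumption.
  + rewrite (is_derive_unique _ _ _ Hvd : Derive (fun y : R => v y) t = a t),
      (is_derive_unique _ _ _ Hfx : Derive (fun y : R => fx y) t = v t * l), Ha.
    field; lra.
- intros t Ht.
  assert (0 < alpha / t) by now apply Rdiv_lt_0_compat.
  nra.
Qed.

(** The function [x t - K * t] has derivative [v t - K <= 0]. *)
Lemma linear_growth (x v : R -> R) (K : R) :
  derivative_on nonneg_half_line x v ->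
  (forall t, 0 < t -> v t <= K) ->
  forall t, 0 <= t -> x t <= x 0 + K * t.
Proof.
intros Hx Hv t Ht.
assert (sub : forall y, pos_half_line y -> nonneg_half_line y).
{ unfold pos_half_line, nonneg_half_line; intros; lra. }
enough (H : x t - K * t <= x 0 - K * 0) by lra.
apply (nonpos_derivative_le_start (fun t => x t - K * t) (fun t => v t - K));
  [| | | exact Ht].
- apply limit_minus.
  + apply (limit1_in_subset _ (D_x nonneg_half_line 0)).
    * unfold D_x, pos_half_line, nonneg_half_line; intros; lra.
    * apply (derivative_at_on_continue_in _ x 0 (v 0)), Hx.
      unfold nonneg_half_line; lra.
  + apply limit_mul; [| apply lim_x].
    intros eps Heps; exists 1; split; [lra | intros y _].
    simpl; unfold Rdist; rewrite Rminus_diag, Rabs_R0; exact Heps.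
- intros s Hs.
  assert (Hxd : is_derive x s (v s)).
  { apply derivative_at_on_is_derive; [exact Hs |].
    apply (derivative_at_on_subset nonneg_half_line); [exact sub |].
    apply Hx, sub, Hs. }
  auto_derive.
  + eexists; eassumption.
  + rewrite (is_derive_unique _ _ _ Hxd : Derive (fun y : R => x y) s = v s).
    ring.
- intros s Hs; specialize (Hv s Hs); lra.
Qed.

Theorem lemma4p3 (g : R -> R)
  (g_convex : convex_on nonneg_half_line g)
  (g_diff : differentiable_on nonneg_half_line g)
  (g0_pos : 0 < g 0)
  (g_lim : is_lim g p_infty 0)
  (alpha : R) (alpha_pos : 0 < alpha)
  (x : R -> R)
  (x_sol : nesterov_solution alpha (rescale g) x) :
  forall t : R, 0 <= t -> rescale g (x t) >= g t.
Proof.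
destruct x_sol as [x_pos [v [a [Hx [Hvc [Hv [_ [Hode [x0 v0]]]]]]]]].
assert (g_mono := convex_lim_nonincreasing g 0 g_convex g_lim).
assert (g_pos := nonincreasing_ge_lim g 0 g_mono g_lim).
assert (sqrt_pos : 0 < sqrt (g 0)) by now apply sqrt_lt_R0.
assert (c_pos : 0 < / (2 * sqrt (g 0))) by (apply Rinv_0_lt_compat; lra).
assert (energy := nesterov_energy_bound (rescale g) x v a alpha alpha_pos
  (rescale_differentiable g g0_pos g_diff) x_pos Hx Hvc Hv Hode).
rewrite x0, v0, rescale_0 in energy.
assert (speed : forall t, 0 < t -> v t <= 2 * sqrt (g 0)).
{ intros t Ht.
  assert (He := energy t (Rlt_le _ _ Ht)).
  assert (Hf : 0 <= rescale g (x t)).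
  { apply g_pos; unfold Rdiv; specialize (x_pos t (Rlt_le _ _ Ht)); nra. }
  assert (Hsq := sqrt_sqrt (g 0) (Rlt_le _ _ g0_pos)).
  (* The energy gives [v t * v t <= 2 * g 0], whereas [v t > 2 * sqrt (g 0)] would make the square
     exceed [4 * g 0]. *)
  nra. }
intros t Ht.
assert (Hxt := linear_growth x v _ Hx speed t Ht).
rewrite x0, Rplus_0_l in Hxt.
(* It remains to see that [0 <= x t / (2 * sqrt (g 0)) <= t]. *)
apply Rle_ge, g_mono.
- unfold Rdiv; specialize (x_pos t Ht); nra.
- apply Rle_div_l; lra.
Qed.
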